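(* Let $U$ be an open neighborhood of the origin in $\mathbb{R}^n$ and let $\Theta(x)=(\Theta_1(x),\ldots,\Theta_{n'}(x))$ be a smooth map from $U$ to $\mathbb{R}^{n'}$. Then, as $t\to0$, we have $$t^{-1}\cdot\Theta(t\cdot x)\simeq\sum_{\ell\ge-w'_{n'}}t^\ell\Theta^{[\ell]}(x)\qquad\text{in }C^\infty(U,\mathbb{R}^{n'}),$$ where $\Theta^{[\ell]}(x)$ is a polynomial map such that $t^{-1}\cdot\Theta^{[\ell]}(t\cdot x)=t^\ell\Theta^{[\ell]}(x)$ for all $t\in\mathbb{R}\setminus\{0\}$; explicitly, $\Theta^{[\ell]}=\big(\Theta_1^{[\ell+w'_1]},\ldots,\Theta_{n'}^{[\ell+w'_{n'}]}\big)$, where for $m\geq 0$ one sets $\Theta_k^{[m]}(x)=\sum_{\langle\alpha\rangle=m}\frac1{\alpha!}\partial_x^\alpha\Theta_k(0)x^\alpha$, and $\Theta_k^{[m]}=0$ for $m<0$.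
   Context: $(w_1,\ldots,w_n)$ is the weight sequence of an $n$-dimensional Carnot manifold of step $r$ (all that matters here is that it is a non-decreasing sequence of integers in $\{1,\ldots,r\}$), and $(w'_1,\ldots,w'_{n'})$ is a non-decreasing sequence of integers with $w'_1=1$ (when $n'=n$ one takes $w'_j=w_j$). The dilations are $t\cdot x=(t^{w_1}x_1,\ldots,t^{w_n}x_n)$ on $\mathbb{R}^n$ and $t\cdot y=(t^{w'_1}y_1,\ldots,t^{w'_{n'}}y_{n'})$ on $\mathbb{R}^{n'}$. For $\alpha\in\mathbb{N}_0^n$, $\langle\alpha\rangle=w_1\alpha_1+\cdots+w_n\alpha_n$. The asymptotic expansion in $C^\infty(U,\mathbb{R}^{n'})$ means that, for every integer $N$, every compact $K\subset U$ and every $\alpha\in\mathbb{N}_0^n$, the supremum over $x\in K$ of $\big|\partial_x^\alpha\big(t^{-1}\cdot\Theta(t\cdot x)-\sum_{-w'_{n'}\le\ell<N}t^\ell\Theta^{[\ell]}(x)\big)\big|$ is $\operatorname{O}(t^N)$ as $t\to0$, $t\ne0$ (for $t$ small, $t\cdot x\in U$ for $x$ near $K$). *)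

(* Defs.v *)
From HB Require Import structures.
From mathcomp Require Import all_boot all_order all_algebra.
From mathcomp Require Import all_classical all_reals all_analysis.
(* Not imported: the notations of mpoly clash with those of mathcomp-analysis. *)
From mathcomp Require mpoly.

Set Implicit Arguments.
Unset Strict Implicit.
Unset Printing Implicit Defensive.

Import Order.TTheory GRing.Theory Num.Theory.
Import numFieldNormedType.Exports.
Local Open Scope classical_set_scope.
Local Open Scope ring_scope.

Definition dilation (R : realType) (n : nat) (w : 'I_n -> nat) (t : R)
    (x : 'rV[R]_n) : 'rV[R]_n :=
  \row_i (t ^+ w i * x 0 i).

Definition wdeg (n : nat) (w a : 'I_n -> nat) : nat := (\sum_i w i * a i)%N.

Definition mfactorial (n : nat) (a : 'I_n -> nat) : nat := (\prod_i (a i)`!)%N.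

Definition mmonomial (R : realType) (n : nat) (a : 'I_n -> nat)
    (x : 'rV[R]_n) : R :=
  \prod_i x 0 i ^+ a i.

Section PartialDerivatives.
Variables (R : realType) (n : nat) (W : normedModType R).
Implicit Types (f : 'rV[R]_n -> W) (s : seq 'I_n) (a : 'I_n -> nat).

Fixpoint iter_partial s f : 'rV[R]_n -> W :=
  if s is i :: s' then 'D_(delta_mx 0 i) (iter_partial s' f) else f.

Definition mpartial a f : 'rV[R]_n -> W :=
  iter_partial (flatten [seq nseq (a i) i | i <- enum 'I_n]) f.

(* Maps on an open set U are represented by total functions; when U is open,
   only the values on U matter here. *)
Definition smooth_on (U : set 'rV[R]_n) f : Prop :=
  forall s x, U x ->
    {for x, continuous (iter_partial s f)} /\
    forall i, derivable (iter_partial s f) x (delta_mx 0 i).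

End PartialDerivatives.

Definition polynomial_map (R : realType) (n m : nat)
    (F : 'rV[R]_n -> 'rV[R]_m) : Prop :=
  exists p : 'I_m -> mpoly.mpoly n R,
    forall x k, F x 0 k = mpoly.meval (fun i => x 0 i) (p k).

Lemma leq_wdeg (n : nat) (w a : 'I_n -> nat) (i : 'I_n) :
  (forall j, (0 < w j)%N) -> (a i <= wdeg w a)%N.
Proof.
move=> w_gt0; rewrite /wdeg (bigD1 i) //=.
by apply: leq_trans (leq_addr _ _); rewrite leq_pmull.
Qed.

(* When the weights are positive, <a> = m forces a i <= m for all i (leq_wdeg),
   so the sum below runs over all the multi-indices a with <a> = m. *)
Definition taylor_nat (R : realType) (n : nat) (w : 'I_n -> nat)
    (f : 'rV[R]_n -> R) (m : nat) (x : 'rV[R]_n) : R :=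
  \sum_(a : {ffun 'I_n -> 'I_m.+1} | wdeg w (fun i => a i) == m)
     (mfactorial (fun i => a i))%:R^-1 * mpartial (fun i => a i) f 0
     * mmonomial (fun i => a i) x.

Definition taylor_part (R : realType) (n : nat) (w : 'I_n -> nat)
    (f : 'rV[R]_n -> R) (l : int) (x : 'rV[R]_n) : R :=
  match l with
  | Posz m => taylor_nat w f m x
  | Negz _ => 0
  end.

Definition homogeneous_part (R : realType) (n m : nat) (w : 'I_n -> nat)
    (w' : 'I_m -> nat) (Theta : 'rV[R]_n -> 'rV[R]_m) (l : int)
    (x : 'rV[R]_n) : 'rV[R]_m :=
  \row_k taylor_part w (fun y => Theta y 0 k) (l + (w' k)%:Z) x.

Definition int_range (a b : int) : seq int :=
  [seq a + j%:Z | j <- iota 0 (absz (Num.max 0 (b - a)))].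

Lemma mem_int_range (a b l : int) : (l \in int_range a b) = (a <= l < b).
Proof.
apply/mapP/andP => [[j] | [al lb]].
  rewrite mem_iota add0n leq0n /= => jlt ->; split; first by rewrite lerDl.
  move: jlt; rewrite -ltz_nat gez0_abs; last by rewrite le_max lexx.
  by rewrite lt_max ltz_nat ltn0 /= ltrBrDl.
exists (absz (l - a)); last by rewrite gez0_abs ?subr_ge0// addrCA subrr addr0.
rewrite mem_iota add0n leq0n /= -ltz_nat !gez0_abs ?subr_ge0//.
  by rewrite lt_max ltrD2r lb orbT.
by rewrite le_max lexx.
Qed.

Lemma int_range_uniq (a b : int) : uniq (int_range a b).
Proof. by rewrite map_inj_uniq ?iota_uniq// => i j /addrI[]. Qed.

(* F t ~ \sum_(l >= l0) t ^ l G l in C^oo(U) as t -> 0, t != 0. The supremum is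
   taken in the extended reals, so that the bound also asserts that it is
   finite; the norm on 'rV_m is the maximum norm. *)
Definition asymptotic_expansion (R : realType) (n m : nat) (U : set 'rV[R]_n)
    (F : R -> 'rV[R]_n -> 'rV[R]_m) (l0 : int)
    (G : int -> 'rV[R]_n -> 'rV[R]_m) : Prop :=
  forall (N : int) (K : set 'rV[R]_n) (a : 'I_n -> nat),
    compact K -> K `<=` U ->
    exists C : R, \forall t \near 0^',
      (ereal_sup
         [set `|mpartial a
                  (fun y => F t y - \sum_(l <- int_range l0 N) t ^ l *: G l y) x|%:E
            | x in K]
       <= (C * `|t| ^ N)%:E)%E.

(* Main.v *)
Require Import Defs.
From mathcomp Require Import all_boot all_order all_algebra.
From mathcomp Require Import all_classical all_reals all_analysis.
From mathcomp Require Import ring lra zify.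
From mathcomp Require mpoly.

(* Componentwise, the error of the expansion is t ^ - w'_k times the Taylor
   remainder of Theta_k of weighted order M = N + w'_k, evaluated at the dilated
   point; applying d^a to it gives a factor t ^ <a>. By the symmetry of second
   derivatives, the partial derivatives of d^a of that remainder, taken in any
   order, vanish at 0 up to weighted order M - <a>. So it suffices that a smooth
   function whose derivatives of weighted order < q vanish at 0 is O(t ^ q) on
   the boxes |y_i| <= |t| ^ w_i rho, which follows by induction on q from the
   mean value theorem along the coordinate axes. *)

Set Implicit Arguments.
Unset Strict Implicit.
Unset Printing Implicit Defensive.

Import Order.TTheory GRing.Theory Num.Theory.
Import numFieldNormedType.Exports.
Local Open Scope classical_set_scope.
Local Open Scope ring_scope.

(** * Directional derivatives along lines, translates and rescaled directions *)

Section DirectionalDerivatives.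
Variables (R : realType) (V W : normedModType R).
Implicit Types (f : V -> W) (x v a : V).

(** The two difference quotients are the same function of [h]. This lets the calculus rules for
    functions of one real variable compute partial derivatives. *)
Lemma is_derive1P f x v d :
  is_derive (0 : R) 1 (fun h : R => f (h *: v + x)) d <-> is_derive x v f d.
Proof.
have E : (fun h : R => h^-1 *:
           (f ((h *: (1 : R) + 0 : R) *: v + x) - f ((0 : R) *: v + x)))
       = (fun h => h^-1 *: ((f \o shift x) (h *: v) - f x)).
  by apply/funext => h /=; rewrite addr0 scale0r add0r [_%:A]mulr1.
split=> -[df Df].
  split; first by apply/derivable1P; exact: df.
  by rewrite -Df /derive /= E.
split; first by move/derivable1P: df.
by rewrite -Df /derive /= E.
Qed.

Lemma is_derive_line f x v s : derivable f (x + s *: v) v ->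
  is_derive s (1 : R) (fun h : R => f (x + h *: v)) ('D_v f (x + s *: v)).
Proof.
have E : (fun h : R => h^-1 *:
           (f (x + (h *: (1 : R) + s : R) *: v) - f (x + s *: v)))
       = (fun h => h^-1 *:
           ((f \o shift (x + s *: v)) (h *: v) - f (x + s *: v))).
  by apply/funext => h /=; rewrite [_%:A]mulr1 scalerDl addrCA.
by move=> df; split; rewrite /derivable /derive /= E.
Qed.

Lemma is_derive_translate f x v a : derivable f (x + a) v ->
  is_derive x v (fun y => f (y + a)) ('D_v f (x + a)).
Proof.
have E : (fun h : R => h^-1 *: (f (h *: v + x + a) - f (x + a)))
       = (fun h => h^-1 *: ((f \o shift (x + a)) (h *: v) - f (x + a))).
  by apply/funext => h /=; rewrite addrA.
by move=> df; split; rewrite /derivable /derive /= E.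
Qed.

(** For [c != 0] the quotient along [c *: v] at [h] is [c] times the quotient along [v] at [c * h],
    and [c * h] tends to 0 without reaching it. Only derivability along [v] is assumed, so this does
    not pass through a differential. *)
Lemma is_derive_scale_dir f x v (c : R) : derivable f x v ->
  is_derive x (c *: v) f (c *: 'D_v f x).
Proof.
move=> df; have [->|c0] := eqVneq c 0.
  by rewrite !scale0r; exact: is_derive0.
have cv : (fun h : R => h^-1 *: ((f \o shift x) (h *: (c *: v)) - f x)) @ 0^'
    --> c *: 'D_v f x.
  rewrite (_ : (fun h : R => _) = (fun h => c *: ((c * h)^-1 *:
      ((f \o shift x) ((c * h) *: v) - f x)))); last first.
    apply/funext => h /=; rewrite !scalerA invfM mulrA divff// mul1r.
    by rewrite (mulrC h c).
  apply: cvgZl_tmp.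
  apply: (@cvg_comp _ _ _ (fun h : R => c * h)
    (fun h => h^-1 *: ((f \o shift x) (h *: v) - f x)) _ (0^')) df.
  move=> A A0; have {A0}A0 : \forall h \near (0 : R), h != 0 -> A h := A0.
  change (\forall h \near (0 : R), h != 0 -> A (c * h)).
  have cc : (fun h : R => c * h) @ (0 : R) --> (0 : R).
    rewrite -[X in _ --> X](mulr0 c); exact: mulrl_continuous.
  have A1 : \forall h \near (0 : R), c * h != 0 -> A (c * h) := cc _ A0.
  by move: A1; apply: filterS => h Ah h0; apply: Ah; exact: mulf_neq0.
split; first by apply/cvg_ex; exists (c *: 'D_v f x).
exact: cvg_lim.
Qed.

End DirectionalDerivatives.

(** * Iterated partial derivatives and the mean value theorem along an axis *)

Section IteratedPartials.
Variables (R : realType) (n : nat).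
Implicit Types (U : set 'rV[R]_n).
Local Notation e i := (delta_mx 0 i : 'rV[R]_n).

Lemma iter_partial_cat (W : normedModType R) s1 s2 (f : 'rV[R]_n -> W) :
  iter_partial (s1 ++ s2) f = iter_partial s1 (iter_partial s2 f).
Proof. by elim: s1 => //= i s ->. Qed.

Lemma smooth_on_partial (W : normedModType R) U (f : 'rV[R]_n -> W) i :
  smooth_on U f -> smooth_on U ('D_(e i) f).
Proof.
by move=> sf s x Ux; have := sf (s ++ [:: i]) x Ux; rewrite iter_partial_cat.
Qed.

(** A derivative at a point depends only on the germ there, and an open [U] is a neighborhood of
    each of its points. *)
Lemma eq_on_iter_partial (W : normedModType R) U (f g : 'rV[R]_n -> W) s :
  open U -> (forall x, U x -> f x = g x) ->
  forall x, U x -> iter_partial s f x = iter_partial s g x.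
Proof.
move=> oU fg; elim: s => //= i s IH x Ux; apply: near_eq_derive.
by near do apply: IH; exact: open_nbhs_nbhs.
Unshelve. all: by end_near. Qed.

(** The device behind the later smoothness proofs: propose a formula [G s] for every iterated
    derivative at once, check that each is continuous and that one more differentiation leads from
    [G s] to [G (i :: s)]; smoothness and the values of all derivatives follow together. *)
Lemma iter_partial_family (W : normedModType R) U
    (G : seq 'I_n -> 'rV[R]_n -> W) : open U ->
  (forall s x, U x -> {for x, continuous (G s)}) ->
  (forall s i x, U x -> is_derive x (e i) (G s) (G (i :: s) x)) ->
  smooth_on U (G [::]) /\
  forall s x, U x -> iter_partial s (G [::]) x = G s x.
Proof.
move=> oU Gc Gd.
have E s : forall x, U x -> iter_partial s (G [::]) x = G s x.
  elim: s => //= i s IH x Ux; have [_ <-] := Gd s i x Ux.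
  by apply: near_eq_derive; near do apply: IH; exact: open_nbhs_nbhs.
split=> // s x Ux.
have nE : {near x, G s =1 iter_partial s (G [::])}.
  by near do rewrite E//; exact: open_nbhs_nbhs.
split.
  rewrite /prop_for /continuous_at E//; apply: cvg_trans (Gc s x Ux).
  exact: (@near_eq_cvg _ _ (nbhs x) _ _ _ nE).
by move=> i; apply: near_eq_derivable nE _; have [] := Gd s i x Ux.
Unshelve. all: by end_near. Qed.

Lemma mvt_partial (f : 'rV[R]_n -> R) x i (c : R) :
  (forall s : R, `|s| <= `|c| -> derivable f (x + s *: e i) (e i)) ->
  exists2 s : R, `|s| <= `|c| &
    f (x + c *: e i) - f x = c * 'D_(e i) f (x + s *: e i).
Proof.
move=> df; pose g s := f (x + s *: e i).
have g0 : g 0 = f x by rewrite /g scale0r addr0.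
have dg (s : R) : `|s| <= `|c| -> is_derive s 1 g ('D_(e i) f (x + s *: e i)).
  by move=> sc; apply: is_derive_line; exact: df.
have cg a b : (forall s, s \in `[a, b]%R -> `|s| <= `|c|) ->
    {within `[a, b], continuous g}.
  move=> ab; apply: derivable_within_continuous => s /ab /dg [dgs _]; exact: dgs.
(* The one-variable theorem needs ordered endpoints, hence one case for each sign of [c]. *)
have [c0|c0] := leP 0 c.
  have S (s : R) : s \in `[0, c]%R -> `|s| <= `|c|.
    by rewrite in_itv /= => /andP[s0 sc]; rewrite !ger0_norm.
  have [s /S sc E] := @MVT_segment _ g _ 0 c c0
    (fun s h => dg s (S s (subset_itv_oo_cc h))) (cg _ _ S).
  by exists s => //; rewrite -g0 -[f _]/(g c) E subr0 mulrC.
have S (s : R) : s \in `[c, 0]%R -> `|s| <= `|c|.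
  by rewrite in_itv /= => /andP[cs s0]; rewrite !ler0_norm ?lerN2// ltW.
have [s /S sc E] := @MVT_segment _ g _ c 0 (ltW c0)
  (fun s h => dg s (S s (subset_itv_oo_cc h))) (cg _ _ S).
exists s => //; rewrite -g0 -[f _]/(g c) -[LHS]opprB E sub0r mulrN opprK.
by rewrite mulrC.
Qed.

End IteratedPartials.

(** * Symmetry of mixed partial derivatives and the mean value inequality on a box *)

Section Symmetry.
Variables (R : realType) (n : nat).
Implicit Types (U : set 'rV[R]_n).
Local Notation e i := (delta_mx 0 i : 'rV[R]_n).

Lemma norm_delta_mx_le (i : 'I_n) : `|e i| <= 1.
Proof.
rewrite [leLHS]/Num.Def.normr/= mx_normrE (bigmax_le _ ler01)// => -[a b] _ /=.
by rewrite mxE; case: (_ && _); rewrite ?normr1 ?normr0.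
Qed.

(** The second difference is the increment along [e i] of [g], itself a difference along [e j]. The
    mean value theorem is applied to [g] in direction [i], then to ['D_(e i) f] in direction [j].
    The left side is symmetric in [i] and [j], which is what yields the symmetry of second
    derivatives. *)
Lemma second_difference U (f : 'rV[R]_n -> R) x i j (h : R) : smooth_on U f ->
  (forall s t : R, `|s| <= `|h| -> `|t| <= `|h| ->
    U (x + s *: e i + t *: e j)) ->
  exists s t : R, [/\ `|s| <= `|h|, `|t| <= `|h| &
    f (x + h *: e i + h *: e j) - f (x + h *: e i) - f (x + h *: e j) + f x
    = h * (h * 'D_(e j) ('D_(e i) f) (x + s *: e i + t *: e j))].
Proof.
move=> sf Ux; pose g y := f (y + h *: e j) - f y.
have dg y : derivable f (y + h *: e j) (e i) -> derivable f y (e i) ->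
    is_derive y (e i) g ('D_(e i) f (y + h *: e j) - 'D_(e i) f y).
  move=> d1 d2; apply: is_deriveB; last exact: derivableP.
  exact: (@is_derive_translate _ _ _ f y (e i) (h *: e j) d1).
have h0 : `|0 : R| <= `|h| by rewrite normr0.
have U1 (s : R) : `|s| <= `|h| -> U (x + s *: e i + h *: e j).
  by move=> sh; exact: Ux.
have U0 (s : R) : `|s| <= `|h| -> U (x + s *: e i).
  by move=> sh; have := Ux s 0 sh h0; rewrite scale0r addr0.
have dfU y k : U y -> derivable f y (e k) by move=> /(sf [::])[_]; exact.
have [s sh Eg] : exists2 s : R, `|s| <= `|h| &
    g (x + h *: e i) - g x = h * 'D_(e i) g (x + s *: e i).
  by apply: mvt_partial => s sh; have [] := dg _ (dfU _ i (U1 s sh)) (dfU _ i (U0 s sh)).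
have [_ Dg] := dg _ (dfU _ i (U1 s sh)) (dfU _ i (U0 s sh)).
have [t th Et] : exists2 t : R, `|t| <= `|h| &
    'D_(e i) f (x + s *: e i + h *: e j) - 'D_(e i) f (x + s *: e i)
    = h * 'D_(e j) ('D_(e i) f) (x + s *: e i + t *: e j).
  apply: (@mvt_partial _ _ ('D_(e i) f) (x + s *: e i) j h) => t th.
  by have [_] := sf [:: i] _ (Ux s t sh th); exact.
exists s, t; split => //.
rewrite -Et -Dg -Eg /g opprB addrA.
by rewrite addrAC.
Qed.

(** Schwarz's argument: the same second difference is expressed through either mixed derivative at
    points near [x], and both mixed derivatives are continuous at [x]. *)
Lemma partial_symmetric U (f : 'rV[R]_n -> R) i j x : open U -> smooth_on U f ->
  U x -> 'D_(e i) ('D_(e j) f) x = 'D_(e j) ('D_(e i) f) x.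
Proof.
move=> oU sf Ux; apply/eqP; rewrite -subr_eq0 -normr_le0.
apply/ler_addgt0Pr => eps eps0; rewrite add0r.
have tri (a b c : R) : `|a - c| < eps / 2 -> `|b - c| < eps / 2 -> `|a - b| <= eps.
  move=> ac bc; rewrite (le_trans (ler_distD c _ _))// [leRHS]splitr.
  by rewrite lerD// ltW// distrC.
pose F := 'D_(e i) ('D_(e j) f); pose G := 'D_(e j) ('D_(e i) f).
have : \forall y \near x, [/\ U y, `|F x - F y| < eps / 2 & `|G x - G y| < eps / 2].
  have e2 : 0 < eps / 2 by rewrite divr_gt0.
  have [/cvgrPdist_lt/(_ _ e2) cF _] := sf [:: i; j] x Ux.
  have [/cvgrPdist_lt/(_ _ e2) cG _] := sf [:: j; i] x Ux.
  have nU : nbhs x U by exact: open_nbhs_nbhs.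
  have nF : nbhs x (fun y => `|F x - F y| < eps / 2) := cF.
  have nG : nbhs x (fun y => `|G x - G y| < eps / 2) := cG.
  by apply: filterS3 nU nF nG => y.
move=> /nbhs_ballP[d /= d0 dP].
(* The points used lie within [h + h], that is [d / 2], of [x], hence inside the open ball of radius
   [d]. *)
pose h := d / 4; have h0 : 0 < h by rewrite divr_gt0.
have hN : `|h| = h by rewrite ger0_norm// ltW.
have near_x (s t : R) k l : `|s| <= `|h| -> `|t| <= `|h| ->
    ball x d (x + s *: e k + t *: e l).
  rewrite hN => sh th; rewrite -ball_normE /ball_ /= -addrA opprD addNKr normrN.
  apply: (@le_lt_trans _ _ (h + h)); last first.
    by rewrite /h; lra.
  rewrite (le_trans (ler_normD _ _))// lerD// normrZ.
    by rewrite (le_trans _ sh)// ler_piMr// norm_delta_mx_le.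
  by rewrite (le_trans _ th)// ler_piMr// norm_delta_mx_le.
have [s [t [sh th E1]]] := @second_difference U f x i j h sf
  (fun s t sh th => let: And3 a _ _ := dP _ (near_x s t i j sh th) in a).
have [s' [t' [sh' th' E2]]] := @second_difference U f x j i h sf
  (fun s t sh th => let: And3 a _ _ := dP _ (near_x s t j i sh th) in a).
have [_ _ G1] := dP _ (near_x s t i j sh th).
have [_ F1 _] := dP _ (near_x s' t' j i sh' th').
(* Both sides are the second difference divided by the square of [h]. *)
have E : F (x + s' *: e j + t' *: e i) = G (x + s *: e i + t *: e j).
  have hn0 : h != 0 by rewrite gt_eqF.
  apply: (mulfI hn0); apply: (mulfI hn0).
  refine (etrans (esym E2) (etrans _ E1)).
  by rewrite [x + h *: e j + _]addrAC -!addrA; congr (_ + _); rewrite addrCA.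
apply: (tri (F x) (G x) _ _ G1); rewrite -E; exact: F1.
Qed.

(** Adjacent transpositions bring any letter of the list to its front ([mv]); induction on [s1] then
    matches the two lists letter by letter. *)
Lemma iter_partial_perm U (f : 'rV[R]_n -> R) s1 s2 x : open U -> smooth_on U f ->
  U x -> perm_eq s1 s2 -> iter_partial s1 f x = iter_partial s2 f x.
Proof.
move=> oU sf Ux s12.
have mv i s t y : U y ->
    iter_partial (s ++ i :: t) f y = iter_partial (i :: s ++ t) f y.
  elim: s y => // j s IH y Uy /=.
  rewrite (@partial_symmetric U _ i j y)//; last first.
    by move=> u z Uz; rewrite -!iter_partial_cat; exact: sf.
  exact: (@eq_on_iter_partial _ _ _ _ _ _ [:: j] oU IH).
elim: s1 s2 x Ux s12 => [s2 x Ux|i s1 IH s2 x Ux s12].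
  by rewrite perm_sym => /perm_nilP ->.
have /splitPr si : i \in s2 by rewrite -(perm_mem s12) mem_head.
case: si s12 => t1 t2; rewrite perm_sym perm_catC perm_sym /= perm_cons => s12.
rewrite mv//; apply: (@eq_on_iter_partial _ _ _ _ _ _ [:: i] oU _ _ Ux) => y Uy.
by apply: IH => //; rewrite (perm_trans s12)// perm_catC.
Qed.

(** The path from 0 to [y] changes one coordinate at a time: [z j] carries the first [j] coordinates
    of [y] and zeros after them. Every intermediate point stays in the box, so each step costs at
    most [rho j * D j]. *)
Lemma box_mvt (f : 'rV[R]_n -> R) (rho D : 'I_n -> R) :
  (forall y : 'rV[R]_n, (forall i, `|y 0 i| <= rho i) ->
     forall i, derivable f y (e i) /\ `|'D_(e i) f y| <= D i) ->
  forall y : 'rV[R]_n, (forall i, `|y 0 i| <= rho i) ->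
    `|f y - f 0| <= \sum_i rho i * D i.
Proof.
move=> fD y yrho.
pose z (j : nat) : 'rV[R]_n := \row_i (if (i < j)%N then y 0 i else 0).
have z0 : z 0%N = 0 by apply/rowP => i; rewrite !mxE.
have zn : z n = y by apply/rowP => i; rewrite !mxE ltn_ord.
have zS (j : 'I_n) : z j.+1 = z j + y 0 j *: e j.
  apply/rowP => i; rewrite !mxE eqxx /= ltnS leq_eqVlt.
  have [->|ij] := eqVneq i j; first by rewrite eqxx ltnn add0r mulr1.
  by rewrite (negbTE (ij : i != j :> nat)) mulr0 addr0.
rewrite -z0 -{1}zn -(@telescope_sumr _ 0 n (f \o z))// big_mkord.
rewrite (le_trans (ler_norm_sum _ _ _))// ler_sum// => j _ /=.
rewrite zS.
have box (s : R) : `|s| <= `|y 0 j| ->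
    forall i, `|(z j + s *: e j) 0 i| <= rho i.
  move=> sy i; rewrite !mxE eqxx /=.
  have [->|ij] := eqVneq i j; first by rewrite ltnn add0r mulr1 (le_trans sy).
  rewrite mulr0 addr0; case: ifP => // _.
  by rewrite normr0 (le_trans _ (yrho i)).
have [s sy ->] : exists2 s : R, `|s| <= `|y 0 j| &
    f (z j + y 0 j *: e j) - f (z j) = y 0 j * 'D_(e j) f (z j + s *: e j).
  by apply: mvt_partial => s sy; have [] := fD _ (box s sy) j.
by rewrite normrM ler_pM//; have [] := fD _ (box s sy) j.
Qed.

End Symmetry.

(** * Functions vanishing to a given weighted order at the origin *)

Section WeightedVanishing.
Variables (R : realType) (n : nat) (w : 'I_n -> nat).
Hypothesis w_gt0 : forall i, (0 < w i)%N.
Implicit Types (U : set 'rV[R]_n) (f : 'rV[R]_n -> R).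
Local Notation e i := (delta_mx 0 i : 'rV[R]_n).

Definition seq_weight (s : seq 'I_n) : nat := (\sum_(i <- s) w i)%N.

(** As the weights are at least 1, [|t| ^+ w i <= |t|] once [|t| <= 1], so the box shrinks to the
    origin with [t]. Dividing by [rho + 1] covers the case [rho = 0]. *)
Lemma near0_box (rho : R) U : 0 <= rho -> nbhs (0 : 'rV[R]_n) U ->
  \forall t \near (0 : R), forall y : 'rV[R]_n,
    (forall i, `|y 0 i| <= `|t| ^+ w i * rho) -> U y.
Proof.
move=> rho0 /nbhs_ballP[d /= d0 dU].
have d'0 : 0 < Num.min 1 (d / (rho + 1)).
  by rewrite lt_min ltr01 divr_gt0// ltr_wpDl.
have nt : \forall t \near (0 : R), `|t| < Num.min 1 (d / (rho + 1)).
  by apply/nbhs_ballP; exists (Num.min 1 (d / (rho + 1))) => // t;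
    rewrite -ball_normE /= sub0r normrN.
apply: filterS nt => t; rewrite lt_min => /andP[t1].
rewrite ltr_pdivlMr ?ltr_wpDl// => td y yt; apply: dU; split => // k i.
rewrite ord1 -ball_normE /ball_ /= mxE sub0r normrN.
apply: le_lt_trans (yt i) (le_lt_trans _ td).
apply: ler_pM => //.
  by rewrite -[leRHS]expr1; apply: ler_wiXn2l => //; exact: ltW.
by rewrite lerDl.
Qed.

(* The mean value inequality on the box gains a factor |t| ^ w i against the
   partial derivative 'D_(e i) f, which vanishes to weighted order q - w i. *)
Lemma weighted_vanishing_bound U (rho : R) q f : open U -> U 0 -> 0 <= rho ->
  smooth_on U f ->
  (forall s, (seq_weight s < q)%N -> iter_partial s f 0 = 0) ->
  exists2 C : R, 0 <= C & \forall t \near (0 : R), forall y : 'rV[R]_n,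
    (forall i, `|y 0 i| <= `|t| ^+ w i * rho) -> `|f y| <= C * `|t| ^+ q.
Proof.
move=> oU U0 rho0; have nU : nbhs (0 : 'rV[R]_n) U by exact: open_nbhs_nbhs.
(* The induction is strong because differentiating along [e i] lowers the order by [w i], and it
   generalizes [f]. At order 0, continuity at the origin gives the constant [|f 0| + 1]. *)
elim/ltn_ind: q f => -[_|q IH] f sf f0.
  exists (`|f 0| + 1); first by rewrite addr_ge0.
  have [/cvgrPdist_le/(_ _ ltr01) cf _] := sf [::] 0 U0.
  have nf : nbhs (0 : 'rV[R]_n) (fun y => `|f 0 - f y| <= 1) := cf.
  have := near0_box rho0 nf; apply: filterS => t tf y /tf {tf}.
  rewrite expr0 mulr1 distrC => tf.
  by rewrite -[f y](subrK (f 0)) addrC (le_trans (ler_normD _ _))// lerD2l.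
have /choice[C HC] : forall i, exists C : R, 0 <= C /\
    \forall t \near (0 : R), forall y : 'rV[R]_n,
    (forall i, `|y 0 i| <= `|t| ^+ w i * rho) ->
    `|'D_(e i) f y| <= C * `|t| ^+ (q.+1 - w i).
  move=> i; have lt_q : (q.+1 - w i < q.+1)%N by rewrite ltn_subrL w_gt0.
  have [|s sq|C] := IH _ lt_q ('D_(e i) f); first exact: smooth_on_partial.
    have := f0 (s ++ [:: i]); rewrite iter_partial_cat; apply.
    by rewrite /seq_weight big_cat big_seq1 /= -ltn_subRL ltn_subCr.
  by exists C.
exists (\sum_i rho * C i).
  by apply: sumr_ge0 => i _; rewrite mulr_ge0//; have [] := HC i.
pose P i (t : R) := forall y : 'rV[R]_n,
    (forall i, `|y 0 i| <= `|t| ^+ w i * rho) ->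
    `|'D_(e i) f y| <= C i * `|t| ^+ (q.+1 - w i).
have H1 : \forall t \near (0 : R), forall i, P i t.
  by apply: (@filter_forall _ _ P (nbhs (0 : R))) => i; have [] := HC i.
have H2 := near0_box rho0 nU.
have H3 : \forall t \near (0 : R), `|t| <= 1.
  apply/nbhs_ballP; exists 1 => //= t; rewrite -ball_normE /= sub0r normrN.
  exact: ltW.
move: H1 H2 H3; apply: filterS3 => t tD tU t1 y yt.
have fE : f 0 = 0 by apply: (f0 [::]); rewrite /seq_weight big_nil.
rewrite -[f y]subr0 -[X in _ - X]fE.
have := @box_mvt _ _ f (fun i => `|t| ^+ w i * rho)
  (fun i => C i * `|t| ^+ (q.+1 - w i)) _ y yt.
move=> /(_ _)/le_trans; apply.
  move=> z zt i; split; last exact: tD.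
  by have [_] := sf [::] z (tU z zt); exact.
rewrite mulr_suml; apply: ler_sum => i _; have [C0 _] := HC i.
(* The exponent [w i + (q.+1 - w i)] is at least [q.+1] even when the subtraction truncates, and
   [|t| <= 1]. *)
rewrite (mulrC _ rho) mulrACA -exprD.
rewrite ler_wpM2l ?mulr_ge0//.
apply: ler_wiXn2l => //.
by rewrite -leq_subLR.
Qed.

End WeightedVanishing.

(** * Derivatives of linear combinations and of monomials *)

Section SmoothCombinations.
Variables (R : realType) (n : nat).
Implicit Types (U : set 'rV[R]_n) (f g : 'rV[R]_n -> R).
Local Notation e i := (delta_mx 0 i : 'rV[R]_n).

Lemma smooth_on_scale_add U f g (c : R) : open U ->
  smooth_on U f -> smooth_on U g ->
  smooth_on U (fun x => c * f x + g x) /\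
  forall s x, U x -> iter_partial s (fun x => c * f x + g x) x
    = c * iter_partial s f x + iter_partial s g x.
Proof.
move=> oU sf sg.
apply: (@iter_partial_family _ _ _ _
  (fun s x => c * iter_partial s f x + iter_partial s g x)) => //.
  move=> s x Ux; have [cf _] := sf s x Ux; have [cg _] := sg s x Ux.
  exact: (cvgD (cvgMl_tmp cf) cg).
move=> s i x Ux; have [_ /(_ i) df] := sf s x Ux.
have [_ /(_ i) dg] := sg s x Ux.
exact: (is_deriveD (is_deriveZ c (derivableP df)) (derivableP dg)).
Qed.

Lemma smooth_on_cst U (c : R) : open U ->
  smooth_on U (cst c) /\
  forall s x, U x -> iter_partial s (cst c) x = if s is [::] then c else 0.
Proof.
move=> oU; apply: (@iter_partial_family _ _ _ _
  (fun s => cst (if s is [::] then c else 0))) => //.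
by move=> s x Ux; exact: cst_continuous.
Qed.

Lemma smooth_on_sum U (I : Type) (r : seq I) (P : pred I) (c : I -> R)
    (g : I -> 'rV[R]_n -> R) : open U -> (forall i, smooth_on U (g i)) ->
  smooth_on U (fun x => \sum_(i <- r | P i) c i * g i x) /\
  forall s x, U x -> iter_partial s (fun x => \sum_(i <- r | P i) c i * g i x) x
    = \sum_(i <- r | P i) c i * iter_partial s (g i) x.
Proof.
move=> oU sg; elim: r => [|i r [sr Er]].
  have -> : (fun x => \sum_(i <- [::] | P i) c i * g i x) = cst 0 :> ('rV[R]_n -> R).
    by apply/funext => x; rewrite big_nil.
  have [s0 E0] := @smooth_on_cst U 0 oU; split=> // s x Ux.
  by rewrite E0// big_nil; case: s.
have [Pi|/negbTE Pi] := boolP (P i).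
  have -> : (fun x => \sum_(i <- i :: r | P i) c i * g i x) =
      (fun x => c i * g i x + \sum_(i <- r | P i) c i * g i x).
    by apply/funext => x; rewrite big_cons Pi.
  have [s0 E0] := smooth_on_scale_add (c i) oU (sg i) sr; split=> // s x Ux.
  by rewrite E0// Er// big_cons Pi.
have -> : (fun x => \sum_(i <- i :: r | P i) c i * g i x) =
    (fun x => \sum_(i <- r | P i) c i * g i x).
  by apply/funext => x; rewrite big_cons Pi.
by split=> // s x Ux; rewrite Er// big_cons Pi.
Qed.

Lemma continuous_prod (I : Type) (r : seq I) (F : I -> 'rV[R]_n -> R) :
  (forall i, continuous (F i)) -> continuous (fun x => \prod_(i <- r) F i x).
Proof.
move=> cF; elim: r => [|i r IH].
  have -> : (fun x => \prod_(i <- [::]) F i x) = cst 1.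
    by apply/funext => x; rewrite big_nil.
  exact: cst_continuous.
have -> : (fun x => \prod_(i <- i :: r) F i x) =
    (fun x => F i x * \prod_(i <- r) F i x).
  by apply/funext => x; rewrite big_cons.
by move=> x; exact: (cvgM (cF i x) (IH x)).
Qed.

(** Differentiating [c] times in one variable produces the falling factorial [a i ^_ c]. It is zero
    when [c] exceeds [a i], so the truncated exponent is harmless. *)
Lemma smooth_on_mmonomial U (a : 'I_n -> nat) : open U ->
  smooth_on U (mmonomial a) /\
  forall s x, U x -> iter_partial s (mmonomial a) x
    = \prod_i ((a i ^_ count_mem i s)%:R * x 0 i ^+ (a i - count_mem i s)).
Proof.
move=> oU; pose G (s : seq 'I_n) (x : 'rV[R]_n) :=
  \prod_i ((a i ^_ count_mem i s)%:R * x 0 i ^+ (a i - count_mem i s)).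
have -> : mmonomial a = G [::].
  apply/funext => x; apply: eq_bigr => i _ /=.
  by rewrite ffactn0 mul1r subn0.
apply: (@iter_partial_family _ _ _ _ G) => //.
  move=> s x _; apply: continuous_prod => i y.
  have cc : {for y, continuous (fun z : 'rV[R]_n => z 0 i)}.
    exact: coord_continuous.
  have ce : continuous (fun z : R => z ^+ (a i - count_mem i s)).
    exact: exprn_continuous.
  exact: (cvgMl_tmp (continuous_comp cc (ce _))).
move=> s j x _; apply/is_derive1P.
set m := (a j - count_mem j s)%N.
set K := (a j ^_ count_mem j s)%:R *
  \prod_(i | i != j) ((a i ^_ count_mem i s)%:R * x 0 i ^+ (a i - count_mem i s)).
(* Along the line in direction [e j] only factor [j] varies; [K] collects everything else. *)
have -> : (fun h : R => G s (h *: e j + x)) = (fun h => K * (h + x 0 j) ^+ m).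
  apply/funext => h; rewrite /G (bigD1 j)//= !mxE !eqxx /= mulr1 /K mulrAC.
  congr (_ * _ * _); apply: eq_bigr => i ij.
  by rewrite !mxE (negbTE ij) andbF mulr0 add0r.
have -> : G (j :: s) x = K * (x 0 j ^+ m.-1 *+ m).
  rewrite /G (bigD1 j)//= eqxx add1n ffactnSr natrM -/m subnS -/m /K.
  have -> : \prod_(i | i != j) ((a i ^_ ((j == i) + count_mem i s))%:R *
      x 0 i ^+ (a i - ((j == i) + count_mem i s))) =
      \prod_(i | i != j) ((a i ^_ count_mem i s)%:R *
      x 0 i ^+ (a i - count_mem i s)).
    by apply: eq_bigr => i ij; rewrite eq_sym (negbTE ij) add0n.
  by rewrite -(mulr_natl (_ ^+ _) m); ring.
apply: (is_deriveZ K).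
have dh : is_derive (0 : R) 1 (fun h : R => h + x 0 j) 1.
  by apply: is_derive_eq; rewrite addr0.
have := is_deriveX m dh.
by rewrite exprfctE add0r [_ *: 1]mulr1 mulr_natl.
Qed.

(** If some variable is differentiated too few times, a positive power of 0 remains; if too many
    times, the falling factorial vanishes. With exact counts the factorials remain. *)
Lemma iter_partial_mmonomial0 (a : 'I_n -> nat) s :
  iter_partial s (mmonomial a) (0 : 'rV[R]_n)
  = if [forall i, count_mem i s == a i] then (mfactorial a)%:R else 0.
Proof.
have [_ ->//] := @smooth_on_mmonomial setT a openT.
case: ifP => [/forallP sa|/negbT]; last first.
  rewrite negb_forall => /existsP[i sai]; apply/eqP.
  rewrite prodf_seq_eq0; apply/hasP; exists i; rewrite ?mem_index_enum//=.
  rewrite mxE mulf_eq0 expf_eq0 eqxx andbT subn_gt0 pnatr_eq0.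
  by rewrite -leqn0 leqNgt ffact_gt0 -ltnNge orbC -neq_ltn.
rewrite /mfactorial natr_prod; apply: eq_bigr => i _.
by rewrite (eqP (sa i)) subnn expr0 mulr1 ffactnn.
Qed.

End SmoothCombinations.

(** * Weighted Taylor polynomials and their remainders *)

Section TaylorRemainder.
Variables (R : realType) (n : nat) (w : 'I_n -> nat).
Hypothesis w_gt0 : forall i, (0 < w i)%N.
Implicit Types (U : set 'rV[R]_n) (f : 'rV[R]_n -> R).

(** The list inside [mpartial], so that [mpartial a f] is [iter_partial (index_seq a) f] by
    definition. *)
Definition index_seq (a : 'I_n -> nat) : seq 'I_n :=
  flatten [seq nseq (a i) i | i <- enum 'I_n].

Lemma count_mem_index_seq (a : 'I_n -> nat) i : count_mem i (index_seq a) = a i.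
Proof.
rewrite count_flatten -map_comp sumnE big_map big_enum /= (bigD1 i)//=.
rewrite count_nseq /= eqxx mul1n big1 ?addn0// => j ji.
by rewrite count_nseq /= (negbTE ji).
Qed.

Lemma perm_index_seq (s : seq 'I_n) : perm_eq s (index_seq (fun i => count_mem i s)).
Proof. by apply/allP => i _ /=; rewrite count_mem_index_seq. Qed.

Lemma seq_weight_count (s : seq 'I_n) : seq_weight w s = wdeg w (fun i => count_mem i s).
Proof.
rewrite /seq_weight /wdeg; elim: s => [|i s IH].
  by rewrite big_nil big1// => i _; rewrite muln0.
rewrite big_cons IH.
under [RHS]eq_bigr do rewrite /= mulnDr.
rewrite big_split /=; congr (_ + _)%N.
rewrite (bigD1 i)//= eqxx muln1 big1 ?addn0// => j ji.
by rewrite eq_sym (negbTE ji) muln0.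
Qed.

Lemma seq_weight_index_seq (a : 'I_n -> nat) :
  seq_weight w (index_seq a) = wdeg w a.
Proof.
by rewrite seq_weight_count; apply: eq_bigr => i _; rewrite count_mem_index_seq.
Qed.

Lemma smooth_on_taylor_nat U f m : open U ->
  smooth_on U (taylor_nat w f m).
Proof.
move=> oU; have sm (a : {ffun 'I_n -> 'I_m.+1}) :
    smooth_on U (mmonomial (R := R) (fun i => a i)).
  by have [] := @smooth_on_mmonomial R n U (fun i => a i) oU.
by have [] := smooth_on_sum (index_enum {ffun 'I_n -> 'I_m.+1})
  (fun a => wdeg w (fun i => a i) == m)
  (fun a => (mfactorial (fun i => a i))%:R^-1 * mpartial (fun i => a i) f 0)
  oU sm.
Qed.

(** At the origin only the monomial whose exponents are the counts of [s] survives, and its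
    factorial cancels the Taylor coefficient's denominator. *)
Lemma iter_partial_taylor_nat0 f m s :
  iter_partial s (taylor_nat w f m) 0
  = if seq_weight w s == m then mpartial (fun i => count_mem i s) f 0 else 0.
Proof.
have sm (a : {ffun 'I_n -> 'I_m.+1}) :
    smooth_on setT (mmonomial (R := R) (fun i => a i)).
  by have [] := @smooth_on_mmonomial R n setT (fun i => a i) openT.
have [_ E] := smooth_on_sum (index_enum {ffun 'I_n -> 'I_m.+1})
  (fun a => wdeg w (fun i => a i) == m)
  (fun a => (mfactorial (fun i => a i))%:R^-1 * mpartial (fun i => a i) f 0)
  openT sm.
rewrite [LHS](E s 0 I) {E sm}.
have z (a : {ffun 'I_n -> 'I_m.+1}) : (fun i => a i : nat) <> (fun i => count_mem i s) ->
    iter_partial s (mmonomial (fun i => a i)) (0 : 'rV[R]_n) = 0.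
  move=> as_; rewrite iter_partial_mmonomial0.
  case: ifP => // /forallP sa; exfalso; apply: as_; apply/funext => i.
  by rewrite (eqP (sa i)).
case: ifPn => [/eqP sm|sm]; last first.
  apply: big1 => a /eqP am; rewrite z ?mulr0// => aE.
  by move: sm; rewrite -am aE seq_weight_count eqxx.
(* Positive weights bound each count by [m], so the counts form one of the indices of the sum. *)
have le_m i : (count_mem i s < m.+1)%N.
  by rewrite ltnS -sm seq_weight_count (@leq_wdeg n w (fun i => count_mem i s) i).
pose a0 : {ffun 'I_n -> 'I_m.+1} := [ffun i => Ordinal (le_m i)].
have a0E : (fun i => a0 i : nat) = (fun i => count_mem i s).
  by apply/funext => i; rewrite ffunE.
rewrite (bigD1 a0) /=; last by rewrite a0E -seq_weight_count sm.
rewrite big1 ?addr0 => [|a /andP[_ aa0]]; last first.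
  rewrite z ?mulr0// => aE; move/eqP: aa0; apply; apply/ffunP => i.
  by apply/val_inj; rewrite /= ffunE /= -(congr1 (fun g => g i) aE).
rewrite iter_partial_mmonomial0 a0E.
have -> : [forall i, count_mem i s == a0 i].
  by apply/forallP => i; rewrite ffunE.
rewrite mulrAC mulVf ?mul1r// pnatr_eq0 -lt0n /mfactorial.
by apply: prodn_gt0 => i; exact: fact_gt0.
Qed.

Definition taylor_remainder f M (x : 'rV[R]_n) : R :=
  f x - \sum_(m < M) taylor_nat w f m x.

(** For [s] of weight below [M], exactly one homogeneous term contributes, the one of degree
    [seq_weight w s]. It gives the derivative of [f] with the directions sorted, which symmetry
    identifies with the derivative along [s]. *)
Lemma taylor_remainder_vanishes U f M : open U -> U 0 -> smooth_on U f ->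
  smooth_on U (taylor_remainder f M) /\
  forall s, (seq_weight w s < M)%N -> iter_partial s (taylor_remainder f M) 0 = 0.
Proof.
move=> oU U0 sf.
have sT (m : 'I_M) : smooth_on U (taylor_nat w f m).
  exact: smooth_on_taylor_nat.
have [sS ES] := smooth_on_sum (index_enum 'I_M) xpredT (fun=> -1) oU sT.
have [sR ER] := smooth_on_scale_add 1 oU sf sS.
have E : taylor_remainder f M =
    (fun x => 1 * f x + \sum_(m < M) -1 * taylor_nat w f m x).
  apply/funext => x; rewrite /taylor_remainder mul1r -sumrN.
  by congr (_ + _); apply: eq_bigr => m _; rewrite mulN1r.
rewrite E; split=> // s sM.
rewrite ER// ES// (bigD1 (Ordinal sM))//= big1 ?addr0 => [|m ms].
  rewrite iter_partial_taylor_nat0 eqxx mul1r mulN1r.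
  by rewrite (iter_partial_perm oU sf U0 (perm_index_seq s)) subrr.
rewrite iter_partial_taylor_nat0 ifN ?mulr0//.
by apply: contraNN ms => /eqP ms; apply/eqP/val_inj.
Qed.

End TaylorRemainder.

(** * Dilations and the chain rule for rescaled maps *)

Section Dilations.
Variables (R : realType) (n : nat) (w : 'I_n -> nat).
Local Notation e i := (delta_mx 0 i : 'rV[R]_n).

Lemma seq_weight_cons i s : seq_weight w (i :: s) = (w i + seq_weight w s)%N.
Proof. by rewrite /seq_weight big_cons. Qed.

Lemma mmonomial_dilation (a : 'I_n -> nat) t (x : 'rV[R]_n) :
  mmonomial a (dilation w t x) = t ^+ wdeg w a * mmonomial a x.
Proof.
rewrite /mmonomial /wdeg -prodrXr -big_split /=.
by apply: eq_bigr => i _; rewrite mxE exprMn exprM.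
Qed.

Lemma taylor_nat_dilation (f : 'rV[R]_n -> R) m t x :
  taylor_nat w f m (dilation w t x) = t ^+ m * taylor_nat w f m x.
Proof.
rewrite /taylor_nat mulr_sumr; apply: eq_bigr => a /eqP am.
by rewrite mmonomial_dilation am mulrCA.
Qed.

Lemma continuous_row (T : topologicalType) m (g : T -> 'rV[R]_m) x :
  (forall k, {for x, continuous (fun y => g y 0 k)}) -> {for x, continuous g}.
Proof.
move=> cg; apply/cvgrPdist_le => /= eps eps0.
pose P (k : 'I_m) y := `|g x 0 k - g y 0 k| <= eps.
have nP : nbhs x (fun y => forall k, P k y).
  apply: (@filter_forall _ _ P (nbhs x)) => k.
  by have /cvgrPdist_le/(_ _ eps0) := cg k.
move: nP; apply: filterS => y Py.
rewrite [leLHS]/Num.Def.normr/= mx_normrE (bigmax_le _ (ltW eps0))//= => -[i j] _.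
by rewrite ord1 !mxE /=; exact: Py.
Qed.

Lemma is_derive_row (V : normedModType R) m (g : V -> 'rV[R]_m) x v (d : 'rV[R]_m) :
  (forall k, is_derive x v (fun y => g y 0 k) (d 0 k)) -> is_derive x v g d.
Proof.
move=> dg; have D : derivable g x v.
  by apply/derivable_mxP => i j; rewrite ord1; have [] := dg j.
split=> //; rewrite derive_mx//; apply/matrixP => i j.
by rewrite mxE ord1; have [] := dg j.
Qed.

Lemma continuous_dilation t : continuous (dilation w t : 'rV[R]_n -> 'rV[R]_n).
Proof.
move=> x; apply: continuous_row => k.
have -> : (fun y : 'rV[R]_n => dilation w t y 0 k) = (fun y => t ^+ w k * y 0 k).
  by apply/funext => y; rewrite mxE.
have cc : {for x, continuous (fun z : 'rV[R]_n => z 0 k)}.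
  exact: coord_continuous.
exact: (cvgMl_tmp cc).
Qed.

(** The dilation sends the line through [x] along [e i] to the line through its image along
    [t ^+ w i *: e i]. *)
Lemma is_derive_dilation (f : 'rV[R]_n -> R) t x i :
  derivable f (dilation w t x) (e i) ->
  is_derive x (e i) (fun y => f (dilation w t y))
    (t ^+ w i * 'D_(e i) f (dilation w t x)).
Proof.
move=> df; apply/is_derive1P.
have := is_derive_scale_dir (t ^+ w i) df => /is_derive1P.
congr is_derive; apply/funext => h; congr f; apply/rowP => j.
rewrite !mxE eqxx /=; have [->|_] := eqVneq j i; last by rewrite !mulr0 !add0r.
by rewrite !mulr1 mulrDr (mulrC h).
Qed.

Lemma smooth_on_coord U m (F : 'rV[R]_n -> 'rV[R]_m) k : open U ->
  smooth_on U F -> smooth_on U (fun x => F x 0 k).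
Proof.
move=> oU sF; have [] // := @iter_partial_family R n R U
  (fun s x => iter_partial s F x 0 k) oU.
  move=> s x Ux; have [cF _] := sF s x Ux.
  exact: (continuous_comp cF (@coord_continuous _ _ _ _ _ _)).
move=> s i x Ux; have [_ /(_ i) dF] := sF s x Ux.
split; first by move/derivable_mxP: dF.
by rewrite /= derive_mx// mxE.
Qed.

(** Each differentiation along [e i] releases a factor [t ^+ w i]. The family [G] of expected
    derivatives is checked on the preimage of [U] under the dilation, which is open by
    continuity. *)
Lemma iter_partial_rescaled U m (w' : 'I_m -> nat) (Q : 'I_m -> 'rV[R]_n -> R) t :
  open U -> (forall k, smooth_on U (Q k)) ->
  forall s x, U (dilation w t x) ->
  iter_partial s (fun y => \row_k (t^-1 ^+ w' k * Q k (dilation w t y))) x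
  = \row_k (t^-1 ^+ w' k *
            (t ^+ seq_weight w s * iter_partial s (Q k) (dilation w t x))).
Proof.
move=> oU sQ.
pose G s (y : 'rV[R]_n) := \row_k (t^-1 ^+ w' k *
  (t ^+ seq_weight w s * iter_partial s (Q k) (dilation w t y))).
have oV : open (dilation w t @^-1` U).
  by apply: open_comp => // x _; exact: continuous_dilation.
have -> : (fun y => \row_k (t^-1 ^+ w' k * Q k (dilation w t y))) = G [::].
  apply/funext => y; apply/rowP => k.
  by rewrite !mxE /seq_weight big_nil expr0 mul1r.
have [] // := @iter_partial_family R n _ (dilation w t @^-1` U) G oV.
  move=> s x Ux; apply: continuous_row => k.
  have -> : (fun y => G s y 0 k) = (fun y => t^-1 ^+ w' k *
      (t ^+ seq_weight w s * iter_partial s (Q k) (dilation w t y))).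
    by apply/funext => y; rewrite mxE.
  have [cQ _] := sQ k s _ Ux.
  exact: (cvgMl_tmp (cvgMl_tmp (continuous_comp (@continuous_dilation t x) cQ))).
move=> s i x Ux; apply: is_derive_row => k.
have -> : (fun y => G s y 0 k) = (fun y => t^-1 ^+ w' k *
    (t ^+ seq_weight w s * iter_partial s (Q k) (dilation w t y))).
  by apply/funext => y; rewrite mxE.
rewrite mxE seq_weight_cons exprD (mulrC (t ^+ w i)) -(mulrA (t ^+ seq_weight _ _)).
have [_ /(_ i) dQ] := sQ k s _ Ux.
exact: (is_deriveZ _ (is_deriveZ _ (is_derive_dilation dQ))).
Qed.

End Dilations.

(** * Homogeneous parts, and the expansion error as a rescaled Taylor remainder *)

Section HomogeneousParts.
Import (canonicals) mpoly.
Variables (R : realType) (n : nat) (w : 'I_n -> nat).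
Implicit Types (f : 'rV[R]_n -> R).

Lemma polynomial_taylor_part f l : exists p : mpoly.mpoly n R,
  forall x, taylor_part w f l x = mpoly.meval (fun i => x 0 i) p.
Proof.
case: l => m; last by exists 0 => x; rewrite mpoly.meval0.
pose c (a : {ffun 'I_n -> 'I_m.+1}) : R :=
  (mfactorial (fun i => a i))%:R^-1 * mpartial (fun i => a i) f 0.
pose mon (a : {ffun 'I_n -> 'I_m.+1}) : mpoly.mpoly n R :=
  mpoly.mpolyX R (mpoly.Multinom [tuple (a i : nat) | i < n]).
exists (\sum_(a : {ffun 'I_n -> 'I_m.+1} | wdeg w (fun i => a i) == m)
  c a *: mon a) => x.
rewrite raddf_sum; apply: eq_bigr => a _ /=.
rewrite mpoly.mevalZ mpoly.mevalX; congr (_ * _).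
by apply: eq_bigr => i _; rewrite mpoly.mnmE.
Qed.

Lemma polynomial_homogeneous_part m (w' : 'I_m -> nat)
    (Theta : 'rV[R]_n -> 'rV[R]_m) l :
  polynomial_map (homogeneous_part w w' Theta l).
Proof.
have /choice[p pE] k := polynomial_taylor_part (fun y => Theta y 0 k) (l + (w' k)%:Z).
by exists p => x k; rewrite mxE pE.
Qed.

Lemma taylor_part_dilation f (c : nat) l t x : t != 0 ->
  t^-1 ^+ c * taylor_part w f (l + c%:Z) (dilation w t x)
  = t ^ l * taylor_part w f (l + c%:Z) x.
Proof.
move=> t0; case E : (l + c%:Z) => [m|m] /=; last by rewrite !mulr0.
rewrite taylor_nat_dilation mulrA; congr (_ * _).
have -> : l = m%:Z - c%:Z by rewrite -[Posz m]E addrK.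
by rewrite expfzDr// -exprnN exprVn mulrC.
Qed.

Lemma homogeneous_part_dilation m (w' : 'I_m -> nat)
    (Theta : 'rV[R]_n -> 'rV[R]_m) l t x : t != 0 ->
  dilation w' t^-1 (homogeneous_part w w' Theta l (dilation w t x))
  = t ^ l *: homogeneous_part w w' Theta l x.
Proof.
by move=> t0; apply/rowP => k; rewrite !mxE taylor_part_dilation.
Qed.

(** Reindexing by [m = l + c]: terms with [l + c < 0] are zero, and [l0 + c <= 0] ensures that the
    range starts low enough to reach [m = 0]. If [N + c <= 0], the sum on the right is empty. *)
Lemma sum_taylor_part f (c : nat) (l0 N : int) t x : t != 0 -> l0 + c%:Z <= 0 ->
  \sum_(l <- int_range l0 N) t ^ l * taylor_part w f (l + c%:Z) x
  = t^-1 ^+ c * \sum_(m < absz (Num.max 0 (N + c%:Z)))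
      taylor_nat w f m (dilation w t x).
Proof.
move=> t0 l0c; rewrite (bigID (fun l => 0 <= l + c%:Z)) /= [X in _ + X]big1 ?addr0.
  rewrite -big_filter.
  rewrite (perm_big [seq m%:Z - c%:Z | m <- iota 0 (absz (Num.max 0 (N + c%:Z)))]).
    rewrite big_map mulr_sumr -(big_mkord xpredT
      (fun m => t^-1 ^+ c * taylor_nat w f m (dilation w t x))) /index_iota subn0.
    apply: eq_bigr => m _; rewrite -taylor_part_dilation//.
    by rewrite subrK.
  apply: uniq_perm.
  - by rewrite filter_uniq// int_range_uniq.
  - by rewrite map_inj_uniq ?iota_uniq// => i j /addIr[].
  move=> l; rewrite mem_filter mem_int_range; apply/idP/mapP.
    move=> lP; exists (absz (l + c%:Z)); last by lia.
    by rewrite mem_iota; lia.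
  by move=> [m]; rewrite mem_iota => mM ->; lia.
by move=> l; case: (l + c%:Z) => // m _; rewrite mulr0.
Qed.

Lemma rescaled_expansionE m (w' : 'I_m -> nat) (Theta : 'rV[R]_n -> 'rV[R]_m)
    (l0 N : int) t : t != 0 -> (forall k, l0 + (w' k)%:Z <= 0) ->
  (fun y => dilation w' t^-1 (Theta (dilation w t y))
     - \sum_(l <- int_range l0 N) t ^ l *: homogeneous_part w w' Theta l y)
  = (fun y => \row_k (t^-1 ^+ w' k *
       taylor_remainder w (fun z => Theta z 0 k)
         (absz (Num.max 0 (N + (w' k)%:Z))) (dilation w t y))).
Proof.
move=> t0 l0w; apply/funext => y; apply/rowP => k; rewrite !mxE summxE mulrBr.
congr (_ - _); rewrite -(@sum_taylor_part _ _ l0)//.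
by apply: eq_bigr => l _; rewrite !mxE.
Qed.

End HomogeneousParts.

(** * Uniform estimates on compact sets and the asymptotic expansion *)

Lemma exprz_weight_le (R : realType) (u : R) (c d M : nat) (N : int) :
  0 < u <= 1 -> N + c%:Z <= M%:Z ->
  u^-1 ^+ c * (u ^+ d * u ^+ (M - d)) <= u ^ N.
Proof.
move=> /andP[u0 u1] NM.
(* With truncation [d + (M - d)] is the maximum of [d] and [M], so the total exponent is at least
   [M - c], hence at least [N]; the surplus is a natural power of [u <= 1]. *)
have -> : u^-1 ^+ c * (u ^+ d * u ^+ (M - d))
    = u ^ N * u ^+ absz ((d + (M - d))%N%:Z - c%:Z - N)%R.
  rewrite -exprD exprVn exprnN -[u ^+ (d + _)]/(u ^ ((d + (M - d))%N%:Z)).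
  rewrite -[u ^+ absz _]/(u ^ (absz ((d + (M - d))%N%:Z - c%:Z - N)%R)%:Z).
  by rewrite -!expfzDr ?gt_eqF//; congr (u ^ _); lia.
by rewrite ler_piMr ?exprz_ge0// ?exprn_ile1// ltW.
Qed.

Lemma compact_coord_bounded (R : realType) n (K : set 'rV[R]_n) : compact K ->
  exists2 rho : R, 0 <= rho & forall x, K x -> forall i, `|x 0 i| <= rho.
Proof.
move=> /compact_bounded[M [_ KM]]; exists (`|M| + 1); first by rewrite addr_ge0.
move=> x Kx i; apply: le_trans (KM (`|M| + 1) _ x Kx).
  rewrite [leRHS]/Num.Def.normr/= mx_normrE.
  exact: (le_bigmax _ (fun ij => `|x ij.1 ij.2|) (0, i)).
by rewrite (le_lt_trans (ler_norm _))// ltrDl.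
Qed.

(** The compact set lies in a box of size [rho], whose dilation by [t] is the box of the weighted
    estimate. That estimate is applied, for each component [k], to the derivative [a] of the Taylor
    remainder [Q k]; the powers of [t] then combine to at least [N]. *)
Lemma asymptotic_expansion_homogeneous (R : realType) n m (w : 'I_n -> nat)
    (w' : 'I_m -> nat) (U : set 'rV[R]_n) (Theta : 'rV[R]_n -> 'rV[R]_m)
    (l0 : int) :
  (forall i, (0 < w i)%N) -> (forall k, l0 + (w' k)%:Z <= 0) ->
  open U -> U 0 -> smooth_on U Theta ->
  asymptotic_expansion U (fun t x => dilation w' t^-1 (Theta (dilation w t x)))
    l0 (homogeneous_part w w' Theta).
Proof.
move=> w_gt0 l0w oU U0 sT N K a cK _.
have [rho rho0 Krho] := compact_coord_bounded cK.
pose M k := absz (Num.max 0 (N + (w' k)%:Z)).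
pose Q k := taylor_remainder w (fun z => Theta z 0 k) (M k).
have HQ k : smooth_on U (Q k) /\
    forall s, (seq_weight w s < M k)%N -> iter_partial s (Q k) 0 = 0.
  by apply: taylor_remainder_vanishes => //; exact: smooth_on_coord.
have sQ k : smooth_on U (Q k) by have [] := HQ k.
pose b := index_seq a.
have /choice[C HC] : forall k, exists C : R, 0 <= C /\
    \forall t \near (0 : R), forall y : 'rV[R]_n,
    (forall i, `|y 0 i| <= `|t| ^+ w i * rho) ->
    `|iter_partial b (Q k) y| <= C * `|t| ^+ (M k - wdeg w a).
  move=> k.
  have sb : smooth_on U (iter_partial b (Q k)).
    by move=> s x Ux; have := sQ k (s ++ b) x Ux; rewrite iter_partial_cat.
  have [|C C0 HC] := @weighted_vanishing_bound R n w w_gt0 U rho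
    (M k - wdeg w a)%N (iter_partial b (Q k)) oU U0 rho0 sb; last by exists C.
  (* Differentiating along [b] first adds [wdeg w a] to the weight of [s], which still stays below
     [M k]. *)
  move=> s sM; rewrite -iter_partial_cat; apply: (HQ k).2.
  by rewrite /seq_weight big_cat /= -!/(seq_weight w _) seq_weight_index_seq; lia.
(* The norm is a maximum over the components, and the sum dominates each [C k]. *)
exists (\sum_k C k).
have C0 k : 0 <= C k by have [] := HC k.
pose P k (t : R) := forall y : 'rV[R]_n,
    (forall i, `|y 0 i| <= `|t| ^+ w i * rho) ->
    `|iter_partial b (Q k) y| <= C k * `|t| ^+ (M k - wdeg w a).
have H1 : \forall t \near (0 : R), forall k, P k t.
  by apply: (@filter_forall _ _ P (nbhs (0 : R))) => k; have [] := HC k.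
have H2 := near0_box w_gt0 rho0 (open_nbhs_nbhs (conj oU U0)).
have H3 : \forall t \near (0 : R), `|t| <= 1.
  apply/nbhs_ballP; exists 1 => //= t; rewrite -ball_normE /= sub0r normrN.
  exact: ltW.
(* The punctured neighborhood filter unfolds to this form. *)
suff : \forall t \near (0 : R), t != 0 ->
    (ereal_sup [set `|mpartial a (fun y =>
        dilation w' t^-1 (Theta (dilation w t y))
        - \sum_(l <- int_range l0 N) t ^ l *: homogeneous_part w w' Theta l y)
        x|%:E | x in K] <= ((\sum_k C k) * `|t| ^ N)%:E)%E by [].
move: H1 H2 H3; apply: filterS3 => t tQ tU t1 t0.
rewrite rescaled_expansionE//.
apply: ge_ereal_sup => _ [x Kx <-]; rewrite lee_fin.
have xbox i : `|dilation w t x 0 i| <= `|t| ^+ w i * rho.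
  by rewrite mxE normrM normrX ler_wpM2l ?exprn_ge0// Krho.
rewrite /mpartial -/(index_seq a) -/b.
rewrite (@iter_partial_rescaled R n w U m w' Q t oU sQ b x (tU _ xbox)).
have u01 : 0 < `|t| <= 1 by rewrite normr_gt0 t0.
have SC0 : 0 <= \sum_k C k by apply: sumr_ge0.
have tN0 : 0 <= `|t| ^ N by rewrite exprz_ge0.
rewrite [leLHS]/Num.Def.normr/= mx_normrE bigmax_le ?mulr_ge0//= => -[i k] _.
rewrite ord1 mxE /= !normrM !normrX normfV seq_weight_index_seq.
apply: (@le_trans _ _ (C k * `|t| ^ N)); last first.
  by rewrite ler_wpM2r// (bigD1 k)//= lerDl sumr_ge0.
have NM : N + (w' k)%:Z <= (M k)%:Z by rewrite /M; lia.
apply: le_trans (ler_wpM2l (C0 k) (exprz_weight_le (wdeg w a) u01 NM)).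
rewrite [leRHS]mulrCA ler_wpM2l ?exprn_ge0 ?invr_ge0//.
rewrite [leRHS]mulrCA ler_wpM2l ?exprn_ge0//.
exact: tQ.
Qed.

Theorem proposition4p20 (R : realType) (n n' r : nat)
    (w : 'I_n -> nat) (w' : 'I_n'.+1 -> nat)
    (w_range : forall i, (1 <= w i <= r)%N)
    (w_mono : forall i j : 'I_n, (i <= j)%N -> (w i <= w j)%N)
    (w'_first : w' ord0 = 1%N)
    (w'_mono : forall i j : 'I_n'.+1, (i <= j)%N -> (w' i <= w' j)%N)
    (w'_eq : n'.+1 = n ->
       forall (i : 'I_n) (j : 'I_n'.+1), i = j :> nat -> w' j = w i)
    (U : set 'rV[R]_n) (U_open : open U) (U_0 : U 0)
    (Theta : 'rV[R]_n -> 'rV[R]_n'.+1) (Theta_smooth : smooth_on U Theta) :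
  asymptotic_expansion U
    (fun t x => dilation w' t^-1 (Theta (dilation w t x)))
    (- (w' ord_max)%:Z) (homogeneous_part w w' Theta)
  /\ forall l : int, - (w' ord_max)%:Z <= l ->
       polynomial_map (homogeneous_part w w' Theta l)
       /\ forall (t : R) (x : 'rV[R]_n), t != 0 ->
            dilation w' t^-1 (homogeneous_part w w' Theta l (dilation w t x))
            = t ^ l *: homogeneous_part w w' Theta l x.
Proof.
split.
  apply: asymptotic_expansion_homogeneous => // [i|k].
    by have /andP[] := w_range i.
  (* By monotonicity the last weight is the largest, so the starting index is low enough for every
     component. *)
  by rewrite addrC subr_le0 lez_nat w'_mono// -ltnS ltn_ord.
move=> l _; split; first exact: polynomial_homogeneous_part.
by move=> t x t0; exact: homogeneous_part_dilation.
Qed.
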